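(* Let $p>2$ be prime and let $k \geq 3$. Let $\Psi$ be a $2\times k$ system over $\mathbb{F}_p$ such that $s(\Psi)=k-1$. Then there exist an integer $n >0$ and a function $f: \mathbb{F}_p^n \to [-1,1]$ with $\mathbb{E}_{x\in\mathbb{F}_p^n} f(x) = 0$ such that $T_\Psi(f) < 0$.
   Context: A $2\times k$ system $\Psi$ is a system of $2$ homogeneous linear equations in $k$ variables, given by a $2\times k$ matrix $M_\Psi$ over $\mathbb{F}_p$ of full rank $2$. For $n\ge1$, $\mathrm{sol}(\Psi;\mathbb{F}_p^n)$ is the set of $x=(x_1,\dots,x_k)\in(\mathbb{F}_p^n)^k$ with $M_\Psi x=0$. For $f:\mathbb{F}_p^n\to\mathbb{C}$, $T_\Psi(f)=\mathbb{E}_{x\in \mathrm{sol}(\Psi;\mathbb{F}_p^n)} f(x_1)\cdots f(x_k)$ (normalised average). The length of an equation is its number of nonzero coefficients; $s(\Psi)$ is the minimum length of a nonzero equation in the row space of $M_\Psi$ (equivalently here, $s(\Psi)=k-1$ means every $2\times2$ minor of $M_\Psi$ is nonsingular). *)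

(* Defs.v *)
From HB Require Import structures.
From mathcomp Require Import all_boot all_order all_algebra.
From mathcomp Require Import reals.
Set Implicit Arguments. Unset Strict Implicit. Unset Printing Implicit Defensive.
Import Order.TTheory GRing.Theory Num.Theory.
Local Open Scope ring_scope.

Definition average (F : numFieldType) (T : finType) (A : {set T}) (g : T -> F) : F :=
  (\sum_(x in A) g x) / #|A|%:R.

(* Number of nonzero coefficients of the equation with coefficient vector v. *)
Definition eqn_length (p k : nat) (v : 'rV['F_p]_k) : nat :=
  #|[set j | v 0 j != 0]|.

(* Minimum length of a nonzero equation in the row space of M.  Lengths never
   exceed k, so the default value k does not affect the minimum when M != 0. *)
Definition min_length (p k : nat) (M : 'M['F_p]_(2, k)) : nat :=
  \big[minn/k]_(v : 'rV['F_p]_k | (v != 0) && (v <= M)%MS) eqn_length v.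

(* A tuple (x_1, ..., x_k) of vectors of F_p^n is encoded as the k x n matrix
   whose i-th row is x_i, so that the system reads M *m x = 0. *)
Definition sol (p k : nat) (M : 'M['F_p]_(2, k)) (n : nat) : {set 'M['F_p]_(k, n)} :=
  [set x | M *m x == 0].

Definition T_avg (F : numFieldType) (p k : nat) (M : 'M['F_p]_(2, k)) (n : nat)
    (f : 'rV['F_p]_n -> F) : F :=
  average (sol M n) (fun x => \prod_(i < k) f (row i x)).

(* Main.v *)
(* Let v j be the columns of M, pairwise independent vectors of F_p^2. In Fourier
   space T is, up to a positive factor, the sum over pairs Y of frequencies of
   the product of the transforms of f at the k combinations v j *m Y. For odd k
   a delta function minus its mean has T > 0, so its opposite works.

   For even k, give f the transform xi |-> chi (<u, g xi>) on a symmetric set S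
   without 0, where g is odd. Averaging T over u, against 1 and against
   chi (- <u, h>), shows that if T >= 0 for all u then the solutions Y with all
   v j *m Y in S and total tag h are at most as many as those with total tag 0.
   To violate this, S consists of the (+-v j, x) with x in F_p^n, tagged by +-e_j
   and the coordinatewise +-P_j (+-x), where sum_j P_j (v j *m y) = 0 identically.
   All Y = (1, Z) have total tag (1, ..., 1; 0), which gives p^(2n) solutions. Total
   tag 0 forces every v j to be sent to a sign times one single v i, and then every
   column of Z avoids some vector, so there are at most p^4 (p^2 - 1)^n solutions.
   The P_j are monomials of degree at most k - 2 weighted by the Lagrange relation,
   and what makes columns of Z avoid a vector is that signs do not satisfy that
   relation. *)

Require Import Defs.
From mathcomp Require Import all_boot all_order all_algebra.
From mathcomp Require Import reals.
From mathcomp Require Import complex.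
Import Order.TTheory GRing.Theory Num.Theory.
Local Open Scope ring_scope.

(** * The Frobenius pairing of matrices *)

Definition frob {F : comNzRingType} {m n : nat} (A B : 'M[F]_(m, n)) : F :=
  \tr (A *m B^T).

Lemma frobE {F : comNzRingType} {m n : nat} (A B : 'M[F]_(m, n)) :
  frob A B = \sum_i \sum_j A i j * B i j.
Proof.
rewrite /frob /mxtrace; apply: eq_bigr => i _; rewrite mxE.
by apply: eq_bigr => j _; rewrite mxE.
Qed.

Lemma frobDr {F : comNzRingType} {m n : nat} (A B C : 'M[F]_(m, n)) :
  frob A (B + C) = frob A B + frob A C.
Proof. by rewrite /frob linearD mulmxDr linearD. Qed.

Lemma frobDl {F : comNzRingType} {m n : nat} (A B C : 'M[F]_(m, n)) :
  frob (A + B) C = frob A C + frob B C.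
Proof. by rewrite /frob mulmxDl linearD. Qed.

Lemma frobNr {F : comNzRingType} {m n : nat} (A B : 'M[F]_(m, n)) :
  frob A (- B) = - frob A B.
Proof. by rewrite /frob linearN mulmxN linearN. Qed.

Lemma frobNl {F : comNzRingType} {m n : nat} (A B : 'M[F]_(m, n)) :
  frob (- A) B = - frob A B.
Proof. by rewrite /frob mulNmx linearN. Qed.

Lemma frob0r {F : comNzRingType} {m n : nat} (A : 'M[F]_(m, n)) : frob A 0 = 0.
Proof. by rewrite /frob trmx0 mulmx0 mxtrace0. Qed.

Lemma frobC {F : comNzRingType} {m n : nat} (A B : 'M[F]_(m, n)) :
  frob A B = frob B A.
Proof.
by rewrite !frobE; do 2!apply: eq_bigr => ? _; rewrite mulrC.
Qed.

Lemma frob_row {F : comNzRingType} {m n : nat} (A B : 'M[F]_(m, n)) :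
  frob A B = \sum_i frob (row i A) (row i B).
Proof.
rewrite frobE; apply: eq_bigr => i _; rewrite frobE big_ord1.
by apply: eq_bigr => j _; rewrite !mxE.
Qed.

Lemma frob_mulmx {F : comNzRingType} {m n q : nat}
    (A : 'M[F]_(m, n)) (B : 'M[F]_(m, q)) (C : 'M[F]_(n, q)) :
  frob B (A *m C) = frob (A^T *m B) C.
Proof. by rewrite /frob trmx_mul mulmxA mxtrace_mulC mulmxA. Qed.

(** * Additive characters of ['F_p] and their orthogonality *)

Lemma prime_root_of_unity (C : numClosedFieldType) (p : nat) :
  prime p -> exists z : C, p.-primitive_root z.
Proof.
move=> p_pr; have p_gt1 := prime_gt1 p_pr.
pose q : {poly C} := \poly_(i < p) 1.
have szq : size q = p by rewrite size_poly_eq ?oner_eq0.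
have [z /rootP qz] : exists z, root q z.
  by apply/closed_rootP; rewrite szq -(ltn_predK p_gt1) eqSS -lt0n -ltnS (ltn_predK p_gt1).
have sz : \sum_(i < p) z ^+ i = 0.
  rewrite -[RHS]qz horner_poly; by apply: eq_bigr => i _; rewrite mul1r.
have zp : z ^+ p = 1.
  by apply/eqP; rewrite -subr_eq0 subrX1 sz mulr0.
(* The order of [z] divides [p]; it is not 1, since then [sz] would read [p = 0] in characteristic
   0. *)
have [m prim_m m_dvd] := prim_order_exists (prime_gt0 p_pr) zp.
move/primeP: p_pr => [_ /(_ m m_dvd) /orP[/eqP m1|/eqP <-]]; last by exists z.
move: prim_m; rewrite m1 => /prim_expr_order; rewrite expr1 => z1.
move: sz; rewrite z1 (eq_bigr (fun=> 1)) => [|i _]; last by rewrite expr1n.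
by rewrite sumr_const card_ord => /eqP; rewrite pnatr_eq0 -leqn0 leqNgt ltnW.
Qed.

Lemma additive_character (C : numClosedFieldType) (p : nat) : prime p ->
  exists chi : 'F_p -> C,
    [/\ {morph chi : a b / a + b >-> a * b},
        forall a, (chi a == 1) = (a == 0)
      & forall a, (chi a)^* = chi (- a)].
Proof.
move=> p_pr; have [z z_prim] := prime_root_of_unity C _ p_pr.
pose chi (a : 'F_p) := z ^+ a.
have chiD : {morph chi : a b / a + b >-> a * b}.
  move=> a b; rewrite /chi -exprD; apply/eqP.
  rewrite (eq_prim_root_expr z_prim) /=; move: (a + b)%N => c.
  by rewrite (Fp_cast p_pr) modn_mod.
have chi0 : chi 0 = 1 by [].
have chi1 a : (chi a == 1) = (a == 0).
  rewrite -chi0 /chi (eq_prim_root_expr z_prim) mod0n modn_small //.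
  by have := ltn_ord a; rewrite {2}(Fp_cast p_pr).
exists chi; split=> // a.
have chi_norm : `|chi a| = 1.
  apply/eqP; rewrite -(pexpr_eq1 (prime_gt0 p_pr)) ?normr_ge0 // -normrX.
  by rewrite /chi exprAC (prim_expr_order z_prim) expr1n normr1.
have chi_neq0 : chi a != 0 by rewrite -normr_gt0 chi_norm.
apply: (mulfI chi_neq0); rewrite -chiD subrr chi0.
by rewrite -normCK chi_norm expr1n.
Qed.

(** Translating [B] by a unit matrix at a nonzero entry of [A] multiplies the sum by [chi (A i j)],
    which is not 1. *)
Lemma sum_character (C : numClosedFieldType) (p : nat) (chi : 'F_p -> C)
    (m n : nat) (A : 'M['F_p]_(m, n)) :
  {morph chi : a b / a + b >-> a * b} ->
  (forall a, (chi a == 1) = (a == 0)) ->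
  \sum_B chi (frob A B) = (A == 0)%:R * #|{: 'M['F_p]_(m, n)}|%:R.
Proof.
move=> chiD chi1; case: eqVneq => [->|A_neq0].
  rewrite mul1r -sumr_const; apply: eq_bigr => B _; apply/eqP.
  by rewrite chi1 frobC frob0r.
move/matrix0Pn: (A_neq0) => [i [j Aij]].
have frobA : frob A (delta_mx i j) = A i j.
  rewrite frobE (bigD1 i) //= (bigD1 j) //= mxE !eqxx mulr1.
  rewrite !big1 ?addr0 // => [l l_neq | l l_neq]; last first.
    by rewrite mxE eqxx (negPf l_neq) mulr0.
  by rewrite big1 // => q _; rewrite mxE (negPf l_neq) mulr0.
rewrite mul0r; set S := \sum_B _.
have : S = chi (A i j) * S.
  rewrite {1}/S (reindex_inj (addrI (delta_mx i j))) mulr_sumr.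
  by apply: eq_bigr => B _; rewrite frobDr chiD frobA.
move/eqP; rewrite -subr_eq0 -{1}[S]mul1r -mulrBl mulf_eq0 subr_eq0 eq_sym.
by rewrite chi1 (negPf Aij) => /eqP.
Qed.

(** * Fourier expansion of sums over the solution set *)

Lemma prod_sum_rows (F : comNzRingType) (K : finNzRingType) (k n : nat)
    (G : 'I_k -> 'rV[K]_n -> F) :
  \prod_i \sum_w G i w = \sum_(x : 'M[K]_(k, n)) \prod_i G i (row i x).
Proof.
rewrite bigA_distr_bigA /= (reindex (fun x : 'M[K]_(k, n) => [ffun i => row i x])).
  by apply: eq_bigr => x _; apply: eq_bigr => i _; rewrite ffunE.
exists (fun g : {ffun 'I_k -> 'rV[K]_n} => \matrix_(i, j) g i 0 j) => [x _|g _].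
  by apply/matrixP => i j; rewrite mxE ffunE mxE.
by apply/ffunP => i; rewrite ffunE; apply/rowP => j; rewrite !mxE.
Qed.

(** Averaging [chi (frob Y (M *m x))] over [Y] detects [M *m x = 0]; moving [M] across the pairing
    lets the sum factor over the rows of [x]. *)
Lemma sum_sol (C : numClosedFieldType) (p : nat) (chi : 'F_p -> C) (k : nat)
    (M : 'M['F_p]_(2, k)) (n : nat) (F : 'rV['F_p]_n -> C) :
  {morph chi : a b / a + b >-> a * b} ->
  (forall a, (chi a == 1) = (a == 0)) ->
  #|{: 'M['F_p]_(2, n)}|%:R * \sum_(x in sol M n) \prod_i F (row i x) =
  \sum_(Y : 'M_(2, n)) \prod_i \sum_w chi (frob (row i (M^T *m Y)) w) * F w.
Proof.
move=> chiD chi1.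
have chi_sum (I : finType) (g : I -> 'F_p) :
    chi (\sum_i g i) = \prod_i chi (g i).
  by apply: (big_morph _ chiD); apply/eqP; rewrite chi1.
under [RHS]eq_bigr => Y _.
  rewrite prod_sum_rows; under eq_bigr => x _ do
    rewrite big_split -chi_sum -frob_row -frob_mulmx.
  over.
rewrite exchange_big big_mkcond mulr_sumr; apply: eq_bigr => x _.
rewrite -mulr_suml; under [X in _ = X * _]eq_bigr => Y _ do rewrite frobC.
rewrite sum_character // inE.
by case: eqP => _; rewrite ?mul1r // !mul0r mulr0.
Qed.

(** The unnormalised inverse Fourier transform of [xi |-> chi (frob u (g xi))] on [S]. *)
Definition char_sum {C : numClosedFieldType} {p : nat} (chi : 'F_p -> C)
    {N D : nat} (S : {set 'rV['F_p]_N}) (g : 'rV['F_p]_N -> 'rV['F_p]_D)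
    (u : 'rV['F_p]_D) (x : 'rV['F_p]_N) : C :=
  \sum_(xi in S) chi (frob u (g xi) - frob xi x).

Definition tagged_solutions {p k : nat} (M : 'M['F_p]_(2, k)) {N D : nat}
    (S : {set 'rV['F_p]_N}) (g : 'rV['F_p]_N -> 'rV['F_p]_D)
    (h : 'rV['F_p]_D) : {set 'M['F_p]_(2, N)} :=
  [set Y | [forall j, row j (M^T *m Y) \in S] &&
           (\sum_j g (row j (M^T *m Y)) == h)].

Lemma char_sum_fourier (C : numClosedFieldType) (p : nat) (chi : 'F_p -> C)
    (N D : nat) (S : {set 'rV['F_p]_N}) (g : 'rV['F_p]_N -> 'rV['F_p]_D)
    (u : 'rV['F_p]_D) (eta : 'rV['F_p]_N) :
  {morph chi : a b / a + b >-> a * b} ->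
  (forall a, (chi a == 1) = (a == 0)) ->
  \sum_w chi (frob eta w) * char_sum chi S g u w =
  (eta \in S)%:R * chi (frob u (g eta)) * #|{: 'rV['F_p]_N}|%:R.
Proof.
move=> chiD chi1.
under eq_bigr => w _ do rewrite /char_sum mulr_sumr.
rewrite exchange_big /=.
transitivity (\sum_(xi in S) chi (frob u (g xi)) *
    ((eta - xi == 0)%:R * #|{: 'rV['F_p]_N}|%:R)).
  apply: eq_bigr => xi _; rewrite -(sum_character _ _ _ _ _ _ chiD chi1) mulr_sumr.
  apply: eq_bigr => w _; rewrite -!chiD frobDl frobNl.
  by congr chi; rewrite addrCA.
have [etaS|etaS] := boolP (eta \in S); last first.
  rewrite !mul0r big1 // => xi xiS; rewrite subr_eq0.
  by case: eqP => [e|_]; [rewrite e xiS in etaS | rewrite mul0r mulr0].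
rewrite (bigD1 eta) //= subrr eqxx !mul1r big1 ?addr0 // => xi /andP[_].
by rewrite subr_eq0 eq_sym => /negPf->; rewrite mul0r mulr0.
Qed.

Lemma sum_sol_char_sum (C : numClosedFieldType) (p : nat) (chi : 'F_p -> C)
    (k : nat) (M : 'M['F_p]_(2, k)) (N D : nat) (S : {set 'rV['F_p]_N})
    (g : 'rV['F_p]_N -> 'rV['F_p]_D) (u : 'rV['F_p]_D) :
  {morph chi : a b / a + b >-> a * b} ->
  (forall a, (chi a == 1) = (a == 0)) ->
  #|{: 'M['F_p]_(2, N)}|%:R *
    \sum_(x in sol M N) \prod_i char_sum chi S g u (row i x) =
  #|{: 'rV['F_p]_N}|%:R ^+ k *
    \sum_(Y : 'M_(2, N) | [forall j, row j (M^T *m Y) \in S])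
       chi (frob u (\sum_j g (row j (M^T *m Y)))).
Proof.
move=> chiD chi1; have chi0 : chi 0 = 1 by apply/eqP; rewrite chi1.
rewrite (sum_sol _ _ _ _ _ _ _ chiD chi1) [in RHS]big_mkcond mulr_sumr.
apply: eq_bigr => Y _; under eq_bigr => i _ do rewrite char_sum_fourier //.
rewrite !big_split /= prodr_const card_ord mulrC; congr (_ * _).
case: ifPn => [/forallP YS|]; last first.
  by rewrite negb_forall => /existsP[j /negPf jS]; rewrite (bigD1 j) //= jS !mul0r.
rewrite big1 ?mul1r => [|j _]; last by rewrite YS.
elim/big_rec2: _ => [|j a b _ ->]; first by rewrite frob0r chi0.
by rewrite frobDr chiD.
Qed.

(** The substitution [xi |-> - xi] turns each term into the conjugate of its partner. *)
Lemma char_sum_conj (C : numClosedFieldType) (p : nat) (chi : 'F_p -> C)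
    (N D : nat) (S : {set 'rV['F_p]_N}) (g : 'rV['F_p]_N -> 'rV['F_p]_D)
    (u : 'rV['F_p]_D) (x : 'rV['F_p]_N) :
  (forall a, (chi a)^* = chi (- a)) ->
  (forall xi, (- xi \in S) = (xi \in S)) ->
  {in S, forall xi, g (- xi) = - g xi} ->
  (char_sum chi S g u x)^* = char_sum chi S g u x.
Proof.
move=> chiJ SN gN; rewrite /char_sum rmorph_sum /= [RHS](reindex_inj oppr_inj).
apply: eq_big => [xi|xi xiS]; first by rewrite SN.
by rewrite chiJ gN // frobNr frobNl opprB opprK addrC.
Qed.

Lemma sum_char_sum (C : numClosedFieldType) (p : nat) (chi : 'F_p -> C)
    (N D : nat) (S : {set 'rV['F_p]_N}) (g : 'rV['F_p]_N -> 'rV['F_p]_D)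
    (u : 'rV['F_p]_D) :
  {morph chi : a b / a + b >-> a * b} ->
  (forall a, (chi a == 1) = (a == 0)) ->
  0 \notin S -> \sum_w char_sum chi S g u w = 0.
Proof.
move=> chiD chi1 S0; have chi0 : chi 0 = 1 by apply/eqP; rewrite chi1.
have := char_sum_fourier _ _ _ _ _ S g u 0 chiD chi1; rewrite (negPf S0) !mul0r => E.
rewrite -[RHS]E.
by apply: eq_bigr => w _; rewrite frobC frob0r chi0 mul1r.
Qed.

(** Orthogonality in [u] picks out the [Y] of total tag [h]. *)
Lemma sum_tagged_solutions (C : numClosedFieldType) (p : nat) (chi : 'F_p -> C)
    (k : nat) (M : 'M['F_p]_(2, k)) (N D : nat) (S : {set 'rV['F_p]_N})
    (g : 'rV['F_p]_N -> 'rV['F_p]_D) (h : 'rV['F_p]_D) :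
  {morph chi : a b / a + b >-> a * b} ->
  (forall a, (chi a == 1) = (a == 0)) ->
  \sum_u chi (- frob u h) *
    \sum_(Y : 'M_(2, N) | [forall j, row j (M^T *m Y) \in S])
       chi (frob u (\sum_j g (row j (M^T *m Y)))) =
  #|{: 'rV['F_p]_D}|%:R * #|tagged_solutions M S g h|%:R.
Proof.
move=> chiD chi1; under eq_bigr => u _ do rewrite mulr_sumr.
rewrite exchange_big /= mulrC.
rewrite -sumr_const mulr_suml big_mkcond [RHS]big_mkcond; apply: eq_bigr => Y _.
rewrite inE; case: ifP => //= _.
under eq_bigr => u _ do rewrite -chiD addrC -frobNr -frobDr frobC.
rewrite sum_character // subr_eq0.
by case: eqP; rewrite ?mul0r.
Qed.

(** * Negative averages from complex sums and from tag counts *)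

Lemma average_lt0 (F : numFieldType) (T : finType) (A : {set T}) (f : T -> F) :
  (0 < #|A|)%N -> (average A f < 0) = (\sum_(x in A) f x < 0).
Proof. by move=> A0; rewrite /average pmulr_llt0 // invr_gt0 ltr0n. Qed.

Lemma sol_card_gt0 (p k : nat) (M : 'M['F_p]_(2, k)) (n : nat) :
  (0 < #|sol M n|)%N.
Proof. by apply/card_gt0P; exists 0; rewrite inE mulmx0. Qed.

Lemma exists_neg_T_avg_of_complex (R : rcfType) (p k : nat)
    (M : 'M['F_p]_(2, k)) (N : nat) (F : 'rV['F_p]_N -> R[i]) :
  (forall x, (F x)^* = F x)%R -> \sum_w F w = 0 ->
  \sum_(x in sol M N) \prod_i F (row i x) < 0 ->
  exists f : 'rV['F_p]_N -> R,
    average [set: 'rV['F_p]_N] f = 0 /\ T_avg M f < 0.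
Proof.
move=> FJ F0 FT; pose f x := complex.Re (F x).
have fF x : (f x)%:C%C = F x by apply: RRe_real; apply/CrealP; apply: FJ.
exists f; split.
  rewrite /average; suff -> : \sum_(x in [set: 'rV_N]) f x = 0 by rewrite mul0r.
  apply: (@complexI R); rewrite rmorph0 rmorph_sum -[RHS]F0 /=.
  by apply: eq_big => [x|x _]; rewrite ?inE ?fF.
rewrite average_lt0 ?sol_card_gt0 // -ltcR rmorph_sum /= rmorph0.
under eq_bigr => x _ do rewrite rmorph_prod /=.
by under eq_bigr => x _ do under eq_bigr => i _ do rewrite fF.
Qed.

(** If all [W u] were nonnegative, the count for [h], their average against unimodular weights,
    would be at most the count for tag 0. *)
Lemma exists_neg_T_avg_of_tags (R : rcfType) (p k : nat)
    (M : 'M['F_p]_(2, k)) (N D : nat) (S : {set 'rV['F_p]_N})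
    (g : 'rV['F_p]_N -> 'rV['F_p]_D) (h : 'rV['F_p]_D) :
  prime p -> 0 \notin S ->
  (forall xi, (- xi \in S) = (xi \in S)) ->
  {in S, forall xi, g (- xi) = - g xi} ->
  (#|tagged_solutions M S g 0| < #|tagged_solutions M S g h|)%N ->
  exists f : 'rV['F_p]_N -> R,
    average [set: 'rV['F_p]_N] f = 0 /\ T_avg M f < 0.
Proof.
move=> p_pr S0 SN gN lt_h.
have [chi [chiD chi1 chiJ]] := additive_character R[i] _ p_pr.
have chi0 : chi 0 = 1 by apply/eqP; rewrite chi1.
have chi_norm a : `|chi a| = 1.
  apply/eqP; rewrite -(@pexpr_eq1 _ _ 2) // normCK chiJ -chiD subrr.
  by rewrite chi0.
pose W u := \sum_(Y : 'M_(2, N) | [forall j, row j (M^T *m Y) \in S])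
       chi (frob u (\sum_j g (row j (M^T *m Y)))).
have WE u := sum_sol_char_sum _ _ _ _ M _ _ S g u chiD chi1.
have q_gt0 m : (0 : R[i]) < #|{: 'M['F_p]_(m, N)}|%:R.
  by rewrite ltr0n; apply/card_gt0P; exists 0.
have [u Wu] : exists u, ~~ (0 <= W u).
  apply/existsP; rewrite -negb_forall; apply/negP => /forallP W_ge0.
  have e0 := sum_tagged_solutions _ _ _ _ M _ _ S g 0 chiD chi1.
  have eh := sum_tagged_solutions _ _ _ _ M _ _ S g h chiD chi1.
  move: lt_h; rewrite -(ltr_nat R[i]) -subr_gt0.
  rewrite -(@pmulr_rgt0 _ #|{: 'rV['F_p]_D}|%:R); last first.
    by rewrite ltr0n; apply/card_gt0P; exists 0.
  rewrite mulrBr -e0 -eh subr_gt0 => /lt_geF/negP; apply.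
  rewrite -[X in X <= _]ger0_norm; last by rewrite eh -natrM ler0n.
  apply: le_trans (ler_norm_sum _ _ _) _; apply: ler_sum => u _.
  rewrite normrM chi_norm mul1r frob0r oppr0 chi0 mul1r ger0_norm //.
  exact: W_ge0.
apply: (exists_neg_T_avg_of_complex _ _ _ _ _ (char_sum chi S g u)).
- by move=> x; apply: char_sum_conj.
- exact: sum_char_sum.
(* [R[i]] is only partially ordered: the failure of [0 <= W u] gives a strict inequality because the
   sum over [sol M N] is real. *)
rewrite real_ltNge ?real0 //; last first.
  apply: rpred_sum => x _; apply: rpred_prod => i _; apply/CrealP.
  exact: char_sum_conj.
apply: contra Wu => T_ge0; rewrite -(pmulr_rge0 _ (exprn_gt0 k (q_gt0 1%N))).
by rewrite -WE pmulr_rge0.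
Qed.

Lemma exists_bounded_of_neg_T_avg (R : realFieldType) (p k : nat)
    (M : 'M['F_p]_(2, k)) (N : nat) (f : 'rV['F_p]_N -> R) :
  average [set: 'rV['F_p]_N] f = 0 -> T_avg M f < 0 ->
  exists f : 'rV['F_p]_N -> R,
    [/\ forall x, -1 <= f x <= 1,
        average [set: 'rV['F_p]_N] f = 0
      & T_avg M f < 0].
Proof.
(* The summand 1 keeps [c] positive; rescaling multiplies [T_avg] by the positive factor
   [c^-1 ^+ k]. *)
move=> f0 fT; pose c := 1 + \sum_x `|f x|.
have c_gt0 : 0 < c by rewrite ltr_wpDr // sumr_ge0.
exists (fun x => c^-1 * f x); split.
- move=> x; rewrite -ler_norml normrM gtr0_norm ?invr_gt0 //.
  rewrite ler_pdivrMl // mulr1 /c (bigD1 x) //= addrCA lerDl.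
  by rewrite addr_ge0 // sumr_ge0.
- by rewrite /average -mulr_sumr -mulrA [X in _ * X]f0 mulr0.
rewrite average_lt0 ?sol_card_gt0 //.
under eq_bigr => x _ do rewrite big_split /= prodr_const card_ord.
rewrite -mulr_sumr pmulr_rlt0 ?exprn_gt0 ?invr_gt0 //.
by rewrite -average_lt0 ?sol_card_gt0.
Qed.

(** * Polynomial relations and power sums *)

Lemma coefM_top (R : nzRingType) (f g : {poly R}) (i j : nat) :
  (size f <= i.+1)%N -> (size g <= j.+1)%N -> (f * g)`_(i + j) = f`_i * g`_j.
Proof.
move=> fi gj; have i_lt : (i < (i + j).+1)%N by rewrite ltnS leq_addr.
rewrite coefM (bigD1 (Ordinal i_lt)) //= addKn big1 ?addr0 // => l.
rewrite -val_eqE /= => l_neq; case: (ltngtP l i) l_neq => // l_i _.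
  rewrite [g`__]nth_default ?mulr0 // (leq_trans gj) //.
  by rewrite ltn_subRL ltn_add2r.
by rewrite nth_default ?mul0r // (leq_trans fi).
Qed.

Lemma size_prod_XsubC_cond (R : comNzRingType) (I : finType) (P : pred I)
    (t : I -> R) : size (\prod_(i | P i) ('X - (t i)%:P)) = #|P|.+1.
Proof.
have -> : \prod_(i | P i) ('X - (t i)%:P) = \prod_(i <- enum P) ('X - (t i)%:P).
  by rewrite big_enum.
by rewrite size_prod_XsubC cardE.
Qed.

Lemma sum_horner_eq0 (F : comNzRingType) (k m : nat) (t c : 'I_k -> F) :
  (forall s, (s < m)%N -> \sum_j c j * t j ^+ s = 0) ->
  forall r : {poly F}, (size r <= m)%N -> \sum_j c j * r.[t j] = 0.
Proof.
move=> ct r sz_r; under eq_bigr => j _ do rewrite horner_coef mulr_sumr.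
rewrite exchange_big /= big1 // => s _.
under eq_bigr => j _ do rewrite mulrCA.
by rewrite -mulr_sumr ct ?mulr0 // (leq_trans (ltn_ord s)).
Qed.

(* Lagrange: the relations among the points (1, t j, ..., t j ^+ (k - 2)) are
   the multiples of (1 / w'(t j)). *)
Lemma power_relation_deriv (F : fieldType) (k : nat) (t c : 'I_k -> F) :
  (forall s, (s < k.-1)%N -> \sum_j c j * t j ^+ s = 0) ->
  let w := \prod_j ('X - (t j)%:P) in
  forall j l, c j * w^`().[t j] = c l * w^`().[t l].
Proof.
move=> ct w j l; have [->//|jl] := eqVneq j l.
(* [r] is [w] without the roots [t j] and [t l]; its degree [k - 2] is within reach of [ct], and
   only the terms [j] and [l] of the relation survive. *)
pose r := \prod_(i | (i != j) && (i != l)) ('X - (t i)%:P).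
have wE : w = ('X - (t j)%:P) * (('X - (t l)%:P) * r).
  by rewrite /w (bigD1 j) //= (bigD1 l) //= eq_sym.
have sz_r : (size r <= k.-1)%N.
  rewrite size_prod_XsubC_cond -[k in k.-1]card_ord.
  rewrite (cardD1 j 'I_k) (cardD1 l [predD1 'I_k & j]) !inE eq_sym jl /= add1n ltnS.
  by apply: subset_leq_card; apply/subsetP => i; rewrite !inE andbT andbC.
have := sum_horner_eq0 _ _ _ _ _ ct r sz_r.
rewrite (bigD1 j) //= (bigD1 l) 1?eq_sym //= big1 ?addr0 => [|i /andP[ij il]].
  rewrite wE !derivM !derivXsubC !hornerE !subrr !(mul0r, addr0, mul1r, add0r) /=.
  move=> /eqP; rewrite addr_eq0 => /eqP e.
  by rewrite mulrCA e mulrN -mulNr opprB mulrCA.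
by rewrite /r (bigD1 i) /= ?ij ?il // hornerM hornerXsubC subrr mul0r mulr0.
Qed.

Lemma horner_deriv_prod_XsubC (F : fieldType) (k : nat) (t : 'I_k -> F) (j : 'I_k) :
  injective t -> (\prod_i ('X - (t i)%:P))^`().[t j] != 0.
Proof.
move=> t_inj; rewrite (bigD1 j) //= derivM derivXsubC !hornerE subrr mul0r addr0.
rewrite horner_prod; apply/prodf_neq0 => i ij.
by rewrite hornerXsubC subr_eq0 (inj_eq t_inj) eq_sym.
Qed.

(** [V] has more rows than columns, so some nonzero [c] kills it; since all [c j * w'(t j)] are
    equal with [w'(t j)] nonzero, no entry of [c] vanishes. *)
Lemma exists_power_relation (F : fieldType) (k : nat) (t : 'I_k -> F) :
  (0 < k)%N -> injective t ->
  exists c : 'I_k -> F, (forall j, c j != 0) /\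
    forall s, (s < k.-1)%N -> \sum_j c j * t j ^+ s = 0.
Proof.
move=> k_gt0 t_inj; pose V := \matrix_(j < k, s < k.-1) t j ^+ s.
have /rowV0Pn [c /sub_kermxP cV c_neq0] : kermx V != 0.
  rewrite -mxrank_eq0 mxrank_ker subn_eq0 -ltnNge.
  by rewrite (leq_ltn_trans (rank_leq_col V)) // prednK.
have cT s : (s < k.-1)%N -> \sum_j c 0 j * t j ^+ s = 0.
  move=> s_lt; have /rowP/(_ (Ordinal s_lt)) := cV; rewrite !mxE => cV0.
  by rewrite -[RHS]cV0; apply: eq_bigr => j _; rewrite mxE.
exists (c 0); split=> // j.
have /rV0Pn[l cl] := c_neq0.
have := power_relation_deriv _ _ _ _ cT j l; apply: contra_eq_neq => ->.
by rewrite mul0r eq_sym mulf_neq0 // horner_deriv_prod_XsubC.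
Qed.

(* With A and B the monic polynomials with roots the t j of sign 1 and -1, the
   vanishing of the signed power sums makes A' B - A B' constant; its
   coefficient at X^(deg (A - B) + deg B - 1) is a nonzero multiple of
   deg (A - B) - deg B. *)
Lemma signed_power_sum_neq0 (p k : nat) (t : 'I_k -> 'F_p) (e : 'I_k -> bool) :
  prime p -> odd p -> ~~ odd k -> (4 <= k)%N -> injective t ->
  exists s : 'I_k.-1, \sum_j (-1) ^+ e j * t j ^+ s != 0.
Proof.
move=> p_pr p_odd k_even k_ge4 t_inj.
apply/existsP; rewrite -[X in is_true X]negbK negb_exists; apply/negP => /forallP e0.
have et s : (s < k.-1)%N -> \sum_j (-1) ^+ e j * t j ^+ s = 0.
  by move=> s_lt; apply/eqP; have := e0 (Ordinal s_lt); rewrite negbK.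
have pcharF := pchar_Fp p_pr.
have k_le_p : (k <= p)%N.
  by rewrite -[k]card_ord -[p in (_ <= p)%N](card_Fp p_pr) (leq_card t).
have k_lt_p : (k < p)%N.
  rewrite ltn_neqAle k_le_p andbT; apply: contra k_even => /eqP->; exact: p_odd.
pose P b : {poly 'F_p} := \prod_(j | e j == b) ('X - (t j)%:P).
pose m b := #|[pred j | e j == b]|.
have sizeP b : size (P b) = (m b).+1 by apply: size_prod_XsubC_cond.
have monicP b : P b \is monic by apply: monic_prod_XsubC.
have rootP b j : e j = b -> (P b).[t j] = 0.
  by move=> ej; rewrite /P (bigD1 j) ?ej //= hornerM hornerXsubC subrr mul0r.
have km : (m false + m true = k)%N.
  rewrite -[RHS]card_ord -(cardC [pred j | e j == false]); congr (_ + _)%N.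
  by apply: eq_card => j; rewrite !inE; case: (e j).
(* The power sum of exponent 0 equates the two counts modulo [p], and both are below [p]. *)
have m_eq : m false = m true.
  have := et 0%N; rewrite ltn_predRL (ltn_trans _ k_ge4) // => /(_ isT).
  rewrite (bigID (fun j => e j == false)) /=.
  rewrite (eq_bigr (fun=> 1)) => [|j /eqP->]; last by rewrite mulr1.
  rewrite sumr_const [X in _ + X](eq_bigr (fun=> -1)) => [|j]; last first.
    by case: (e j) => // _; rewrite mulr1.
  rewrite sumr_const mulNrn.
  have -> : #|[pred j | e j != false]| = m true.
    by apply: eq_card => j; rewrite !inE; case: (e j).
  move/eqP; rewrite subr_eq0 -/(m false) => /eqP/(congr1 (@nat_of_ord _)).
  rewrite !val_Fp_nat //.
  have mlt b : (m b < p)%N.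
    apply: leq_ltn_trans k_lt_p; rewrite -km.
    by case: b; rewrite ?leq_addr ?leq_addl.
  by rewrite !modn_small.
pose w := \prod_j ('X - (t j)%:P).
have wE : w = P false * P true.
  rewrite /w (bigID (fun j => e j == false)) /=; congr (_ * _).
  by apply: eq_bigl => j; case: (e j).
pose E : {poly 'F_p} := (P false)^`() * P true - P false * (P true)^`().
have j0 : 'I_k by exists 0%N; apply: leq_trans k_ge4.
pose c := (-1) ^+ e j0 * w^`().[t j0].
(* At each [t j] one term of [w'] and of [E] survives; they agree up to the sign [(-1) ^+ e j], so
   [E] takes the value [c] at [k] points. *)
have EP j : (E - c%:P).[t j] = 0.
  rewrite /c (power_relation_deriv _ _ _ _ et j0 j) -/w wE derivM /E !hornerE.
  case ej : (e j); rewrite (rootP _ _ ej).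
    by rewrite !mulr0 !add0r mulN1r subrr.
  by rewrite !mul0r addr0 subr0 mul1r subrr.
have Ec : E = c%:P.
  apply/eqP; rewrite -subr_eq0; apply: contraT => E_neq0.
  have := max_poly_roots E_neq0; move=> /(_ (codom t)).
  rewrite size_codom card_ord ltnNge => H; apply: contraT => _.
  have sizeE : (size (E - c%:P)%R <= k)%N.
    have szM b b' : b != b' -> (size ((P b)^`() * P b')%R <= k)%N.
      move=> bb'; apply: leq_trans (size_polyMleq _ _) _; rewrite sizeP addnS /=.
      have -> : k = (m b + m b')%N by rewrite -km; case: b b' bb' => [] []//; rewrite addnC.
      by rewrite leq_add2r -ltnS -sizeP lt_size_deriv ?monic_neq0.
    apply: leq_trans (size_polyD _ _) _; rewrite geq_max size_polyN; apply/andP; split.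
      apply: leq_trans (size_polyD _ _) _.
      by rewrite geq_max size_polyN szM // mulrC szM.
    by apply: leq_trans (size_polyC_leq1 _) _; apply: leq_trans k_ge4.
  move: H; rewrite sizeE; apply.
    by apply/allP => _ /codomP[j ->]; apply/eqP; rewrite EP.
  by rewrite map_inj_uniq ?enum_uniq.
have c_neq0 : c != 0.
  by rewrite mulf_neq0 ?signr_eq0 // horner_deriv_prod_XsubC.
(* Replacing [P false] by [D] leaves [E] unchanged, and the leading terms cancel in [D]. *)
pose D := P false - P true.
have ED : E = D^`() * P true - D * (P true)^`().
  by rewrite /E /D derivB !mulrBl opprB addrA [P true * _]mulrC subrK.
have D_neq0 : D != 0.
  apply: contra c_neq0 => /eqP D0; move: Ec; rewrite ED D0 deriv0 !mul0r subr0.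
  by move/esym/eqP; rewrite polyC_eq0.
set n := m true in m_eq km.
have n_gt1 : (1 < n)%N.
  rewrite ltnNge; apply/negP => n_le1; move: k_ge4.
  by rewrite -km m_eq ltnNge (leq_trans (leq_add n_le1 n_le1)).
have Pn b : (P b)`_n = 1.
  have := monicP b; rewrite monicE lead_coefE sizeP /=.
  by case: b; rewrite ?m_eq => /eqP.
have sizeD : (size D <= n)%N.
  apply/leq_sizeP => i; rewrite leq_eqVlt => /orP[/eqP<-|ni].
    by rewrite coefB !Pn subrr.
  by rewrite coefB !nth_default ?subrr // sizeP ?m_eq.
pose d := (size D).-1.
have size_D : size D = d.+1 by rewrite /d prednK // lt0n size_poly_eq0.
(* The factor ['X] undoes the index shift of the derivative. *)
have coefXd (f : {poly 'F_p}) i : ('X * f^`())`_i = f`_i *+ i.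
  by case: i => [|i]; rewrite coefXM ?mulr0n // coef_deriv.
have sizeXd (f : {poly 'F_p}) : (size ('X * f^`())%R <= size f)%N.
  by apply/leq_sizeP => i f_i; rewrite coefXd nth_default ?mul0rn.
(* [E] is constant and [d + n] is at least 2. Computed from [ED], this coefficient is the leading
   coefficient of [D] times [d - n], while [d < n < p]. *)
have : ('X * E)`_(d + n) = 0.
  rewrite Ec coefXM coefC; case: (d + n)%N (leq_addl d n) => [|[|i]] //.
  by rewrite leqNgt n_gt1.
have szXD : (size ('X * D^`())%R <= d.+1)%N by rewrite -size_D.
have szXP : (size ('X * (P true)^`())%R <= n.+1)%N by rewrite -(sizeP true).
rewrite ED mulrBr mulrA mulrCA coefB !coefM_top ?size_D ?sizeP //.
rewrite !coefXd Pn mulr1 mulrnAr mulr1 => /eqP.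
rewrite -mulr_natr -[D`__ *+ _]mulr_natr -mulrBr mulf_eq0 subr_eq0.
rewrite -[D`__]lead_coefE lead_coef_eq0 (negPf D_neq0) /= => /eqP/(congr1 (@nat_of_ord _)).
rewrite !val_Fp_nat //.
have n_lt : (n < p)%N by apply: leq_ltn_trans k_lt_p; rewrite -km leq_addl.
have dn : (d < n)%N by rewrite -size_D.
rewrite !modn_small //; last exact: ltn_trans n_lt.
by move=> dnE; rewrite dnE ltnn in dn.
Qed.

(** * Pairwise independent vectors in the plane and their signs *)

Definition independent {p k : nat} (v : 'I_k -> 'rV['F_p]_2) : Prop :=
  forall i j, i != j -> col_mx (v i) (v j) \in unitmx.

Lemma independent_coef (p k : nat) (v : 'I_k -> 'rV['F_p]_2) (i j : 'I_k)
    (a b : 'F_p) :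
  independent v -> i != j -> a *: v i = b *: v j -> a = 0 /\ b = 0.
Proof.
move=> v_ind ij e.
have : row_mx a%:M (- b)%:M *m col_mx (v i) (v j) = 0 :> 'rV_2.
  by rewrite mul_row_col !mul_scalar_mx e scaleNr subrr.
move/(congr1 (mulmx^~ (invmx (col_mx (v i) (v j))))).
rewrite mulmxK ?v_ind // mul0mx -[0]row_mx0 => /eq_row_mx[a0 b0].
split; first by move/matrixP/(_ 0 0): a0; rewrite !mxE eqxx mulr1n.
by move/matrixP/(_ 0 0): b0; rewrite !mxE eqxx mulr1n => /eqP; rewrite oppr_eq0 => /eqP.
Qed.

Lemma independent_neq0 (p k : nat) (v : 'I_k -> 'rV['F_p]_2) (i : 'I_k) :
  prime p -> (1 < k)%N -> independent v -> v i != 0.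
Proof.
move=> p_pr k_gt1 v_ind.
have /card_gt0P[j] : (0 < #|[predD1 'I_k & i]|)%N.
  by have := cardD1 i 'I_k; rewrite card_ord add1n => k_eq; rewrite k_eq in k_gt1.
rewrite !inE andbT eq_sym => ij; apply/eqP => vi0.
have [] := independent_coef _ _ _ _ _ 1 0 v_ind ij.
  by rewrite vi0 scaler0 scale0r.
by move/eqP; rewrite oner_eq0.
Qed.

(** Independence separates different indices; for equal indices the signs are separated by
    [v i != 0] and, [p] being odd, by [1 != -1]. *)
Lemma sign_scale_inj (p k : nat) (v : 'I_k -> 'rV['F_p]_2) (i j : 'I_k)
    (a b : bool) :
  prime p -> odd p -> (1 < k)%N -> independent v ->
  (-1) ^+ a *: v i = (-1) ^+ b *: v j -> i = j /\ a = b.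
Proof.
move=> p_pr p_odd k_gt1 v_ind; have [<-|ij] := eqVneq i j; last first.
  by move/(independent_coef _ _ _ _ _ _ _ v_ind ij) => [/eqP]; rewrite signr_eq0.
move/eqP; rewrite -subr_eq0 -scalerBl scaler_eq0.
rewrite (negPf (independent_neq0 _ _ _ _ _ k_gt1 v_ind)) //.
rewrite orbF subr_eq0 => e; split=> //; move: e.
have two_neq0 : (1 : 'F_p) + 1 != 0.
  rewrite -(dvdn_pcharf (pchar_Fp p_pr) 2); apply: contraL p_odd.
  by rewrite dvdn_prime2 // => /eqP->.
have ne1 : (1 == -1 :> 'F_p) = false by rewrite -addr_eq0 (negPf two_neq0).
by case: a b => [] [] //=; rewrite expr1 expr0 ?ne1 // eq_sym ne1.
Qed.

(** * The symmetric support and its odd tags *)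

Definition tag_support {p k : nat} (v : 'I_k -> 'rV['F_p]_2) (n : nat) :
    {set 'rV['F_p]_(2 + n)} :=
  [set xi | [exists jb : 'I_k * bool, lsubmx xi == (-1) ^+ jb.2 *: v jb.1]].

(** For independent [v] and odd [p] the picked pair is unique. Negating [xi] flips the outer sign
    and leaves the argument of [P] unchanged, which makes the tag odd. *)
Definition phase_tag {p k : nat} (v : 'I_k -> 'rV['F_p]_2) {m : nat}
    (P : 'I_k -> 'F_p -> 'rV['F_p]_m) {n : nat} (xi : 'rV['F_p]_(2 + n)) :
    'rV['F_p]_(k + n * m) :=
  if [pick jb : 'I_k * bool | lsubmx xi == (-1) ^+ jb.2 *: v jb.1] is Some jb
  then (-1) ^+ jb.2 *: row_mx (delta_mx 0 jb.1)
         (mxvec (\matrix_(l < n) P jb.1 ((-1) ^+ jb.2 * rsubmx xi 0 l)))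
  else 0.

Lemma phase_tagE (p k : nat) (v : 'I_k -> 'rV['F_p]_2) (m : nat)
    (P : 'I_k -> 'F_p -> 'rV['F_p]_m) (n : nat) (xi : 'rV['F_p]_(2 + n))
    (j : 'I_k) (b : bool) :
  prime p -> odd p -> (1 < k)%N -> independent v ->
  lsubmx xi = (-1) ^+ b *: v j ->
  phase_tag v P xi = (-1) ^+ b *: row_mx (delta_mx 0 j)
         (mxvec (\matrix_(l < n) P j ((-1) ^+ b * rsubmx xi 0 l))).
Proof.
move=> p_pr p_odd k_gt1 v_ind xiE; rewrite /phase_tag; case: pickP => [[i a] /= /eqP|].
  by rewrite xiE => /(sign_scale_inj _ _ _ _ _ _ _ p_pr p_odd k_gt1 v_ind)[-> ->].
by move/(_ (j, b)); rewrite /= xiE eqxx.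
Qed.

Lemma tag_supportP (p k : nat) (v : 'I_k -> 'rV['F_p]_2) (n : nat)
    (xi : 'rV['F_p]_(2 + n)) :
  reflect (exists j (b : bool), lsubmx xi = (-1) ^+ b *: v j) (xi \in tag_support v n).
Proof.
rewrite inE; apply: (iffP existsP) => [[[j b] /eqP]|[j [b xiE]]]; first by exists j, b.
by exists (j, b); rewrite xiE.
Qed.

Lemma tag_supportN (p k : nat) (v : 'I_k -> 'rV['F_p]_2) (n : nat)
    (xi : 'rV['F_p]_(2 + n)) :
  (- xi \in tag_support v n) = (xi \in tag_support v n).
Proof.
suff N (x : 'rV['F_p]_(2 + n)) : x \in tag_support v n -> - x \in tag_support v n.
  by apply/idP/idP => /N; rewrite ?opprK.
move=> /tag_supportP[j [b xE]]; apply/tag_supportP; exists j, (~~ b).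
by rewrite linearN /= xE signrN scaleNr.
Qed.

Lemma tag_support0 (p k : nat) (v : 'I_k -> 'rV['F_p]_2) (n : nat) :
  prime p -> (1 < k)%N -> independent v -> 0 \notin tag_support v n.
Proof.
move=> p_pr k_gt1 v_ind; apply/tag_supportP => -[j [b]]; rewrite linear0 => /esym/eqP.
by rewrite scaler_eq0 signr_eq0 (negPf (independent_neq0 _ _ _ _ p_pr k_gt1 v_ind)).
Qed.

Lemma phase_tagN (p k : nat) (v : 'I_k -> 'rV['F_p]_2) (m : nat)
    (P : 'I_k -> 'F_p -> 'rV['F_p]_m) (n : nat) :
  prime p -> odd p -> (1 < k)%N -> independent v ->
  {in tag_support v n, forall xi, phase_tag v P (- xi) = - phase_tag v P xi}.
Proof.
move=> p_pr p_odd k_gt1 v_ind xi /tag_supportP[j [b xiE]].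
rewrite (phase_tagE _ _ _ _ _ _ _ _ _ p_pr p_odd k_gt1 v_ind xiE).
rewrite (phase_tagE _ _ _ _ _ _ _ j (~~ b) p_pr p_odd k_gt1 v_ind); last first.
  by rewrite linearN /= xiE signrN scaleNr.
rewrite signrN scaleNr; congr (- (_ *: row_mx _ (mxvec _))).
by apply/row_matrixP => l; rewrite !rowK linearN /= mxE mulrNN.
Qed.

Lemma phase_tag_row_mx (p k : nat) (v : 'I_k -> 'rV['F_p]_2) (m : nat)
    (P : 'I_k -> 'F_p -> 'rV['F_p]_m) (n : nat) (j i : 'I_k) (b : bool)
    (X : 'M['F_p]_2) (Z : 'M['F_p]_(2, n)) :
  prime p -> odd p -> (1 < k)%N -> independent v ->
  v j *m X = (-1) ^+ b *: v i ->
  phase_tag v P (v j *m row_mx X Z) = (-1) ^+ b *: row_mx (delta_mx 0 i)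
    (mxvec (\matrix_(l < n) P i ((-1) ^+ b * (v j *m col l Z) 0 0))).
Proof.
move=> p_pr p_odd k_gt1 v_ind vX; rewrite mul_mx_row.
have xiE : lsubmx (row_mx (v j *m X) (v j *m Z)) = (-1) ^+ b *: v i.
  by rewrite row_mxKl.
rewrite (phase_tagE _ _ _ _ _ _ _ _ _ p_pr p_odd k_gt1 v_ind xiE) row_mxKr.
congr (_ *: row_mx _ (mxvec _)); apply/row_matrixP => l; rewrite !rowK.
by congr (P i (_ * _)); rewrite colE mulmxA -colE !mxE.
Qed.

(** * Counting tagged solutions from below and from above *)

Lemma tagged_solutions_lower (p k : nat) (M : 'M['F_p]_(2, k)) (m : nat)
    (P : 'I_k -> 'F_p -> 'rV['F_p]_m) (n : nat) :
  let v j := row j M^T in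
  prime p -> odd p -> (1 < k)%N -> independent v ->
  (forall y : 'cV_2, \sum_j P j ((v j *m y) 0 0) = 0) ->
  (#|{: 'M['F_p]_(2, n)}| <=
   #|tagged_solutions M (tag_support v n) (phase_tag v P) (row_mx (const_mx 1%R) 0%R)|)%N.
Proof.
move=> v p_pr p_odd k_gt1 v_ind P0.
(* With left block 1 every [v j] keeps its index and sign, so the index blocks sum to all ones and
   the [P] blocks cancel column by column. *)
pose f (Z : 'M['F_p]_(2, n)) : 'M_(2, 2 + n) := row_mx 1%:M Z.
have f_inj : injective f by move=> Z Z' /eq_row_mx[].
rewrite -cardsT -(card_imset _ f_inj); apply: subset_leq_card.
apply/subsetP => _ /imsetP[Z _ ->]; rewrite inE.
have vX j : v j *m 1%:M = (-1) ^+ false *: v j by rewrite mulmx1 scale1r.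
apply/andP; split.
  apply/forallP => j; apply/tag_supportP; exists j, false.
  by rewrite row_mul mul_mx_row row_mxKl -vX.
apply/eqP; under eq_bigr => j _.
  rewrite row_mul (phase_tag_row_mx _ _ _ _ _ _ _ _ _ _ _ p_pr p_odd k_gt1 v_ind (vX j)).
  rewrite scale1r; over.
apply/rowP => q; rewrite summxE -(splitK q); case: split => r; rewrite /= ?row_mxEl ?row_mxEr.
  rewrite mxE (bigD1 r) //= row_mxEl mxE !eqxx big1 ?addr0 // => j jr.
  by rewrite row_mxEl mxE eq_sym (negPf jr).
under eq_bigr => j _ do rewrite row_mxEr.
case/mxvec_indexP: r => l s; rewrite mxE.
have /rowP/(_ s) := P0 (col l Z); rewrite summxE mxE => {2}<-.
by apply: eq_bigr => j _; rewrite mxvecE mxE mul1r.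
Qed.

(** In a vanishing signed sum no index is hit exactly once. Two different values of [f] would make
    [X] invertible, and then two indices with the same image would coincide. *)
Lemma const_of_signed_sum_eq0 (p k : nat) (v : 'I_k -> 'rV['F_p]_2)
    (X : 'M['F_p]_2) (e : 'I_k -> bool) (f : 'I_k -> 'I_k) :
  prime p -> odd p -> (1 < k)%N -> independent v ->
  (forall j, v j *m X = (-1) ^+ e j *: v (f j)) ->
  \sum_j (-1) ^+ e j *: delta_mx 0 (f j) = 0 :> 'rV['F_p]_k ->
  forall i j, f i = f j.
Proof.
move=> p_pr p_odd k_gt1 v_ind vX sum0 i0.
have [j ji /eqP fj] : exists2 j, j != i0 & f j == f i0.
  apply/exists_inP; apply: contraT; rewrite negb_exists => /forallP no_j.
  move/rowP/(_ (f i0)): sum0; rewrite summxE (bigD1 i0) //= !mxE !eqxx mulr1.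
  rewrite big1 => [/eqP|j ji].
    by rewrite addr0 signr_eq0.
  have := no_j j; rewrite ji /= => fj; rewrite !mxE eq_sym (negPf fj) mulr0 //.
suff const i : f i = f i0 by move=> i; rewrite const.
apply: contraTeq ji => fi; rewrite negbK; apply/eqP.
have vXi l : v (f l) = ((-1) ^+ e l *: v l) *m X.
  by rewrite -scalemxAl vX scalerA -signr_addb addbb scale1r.
have : X \in unitmx.
  have := v_ind _ _ fi; rewrite [v (f i)]vXi [v (f i0)]vXi -mul_col_mx.
  by rewrite unitmx_mul => /andP[].
rewrite -row_free_unit => /row_free_inj X_inj.
have /X_inj ej : ((-1) ^+ e j *: v j) *m X = ((-1) ^+ e i0 *: v i0) *m X.
  by rewrite -!vXi fj.
by case: (sign_scale_inj _ _ _ _ _ _ _ p_pr p_odd k_gt1 v_ind ej).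
Qed.

Lemma tagged_solutions_upper (p k : nat) (M : 'M['F_p]_(2, k)) (m : nat)
    (P : 'I_k -> 'F_p -> 'rV['F_p]_m) (n : nat) :
  let v j := row j M^T in
  prime p -> odd p -> (1 < k)%N -> independent v ->
  (forall i (e : 'I_k -> bool) (phi : 'cV_2),
    (forall j, (v j *m phi) 0 0 = (-1) ^+ e j) ->
    exists y : 'cV_2, \sum_j (-1) ^+ e j *: P i ((-1) ^+ e j * (v j *m y) 0 0) != 0) ->
  (#|tagged_solutions M (tag_support v n) (phase_tag v P) 0%R| <=
   #|{: 'M['F_p]_2}| * (#|{: 'cV['F_p]_2}|.-1) ^ n)%N.
Proof.
move=> v p_pr p_odd k_gt1 v_ind Pneq0.
set T := tagged_solutions _ _ _ _.
(* A left block [X] excludes one vector [y] as a column of [Z]; if no solution has this left block,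
   any [y] serves. *)
have avoid (X : 'M['F_p]_2) : exists y : 'cV['F_p]_2, forall Z : 'M_(2, n),
    row_mx X Z \in T -> forall l, col l Z != y.
  have [Y|noY] := pickP [pred Y in T | lsubmx Y == X]; last first.
    exists 0 => Z ZT; have := noY (row_mx X Z).
    by rewrite inE /= ZT row_mxKl eqxx.
  rewrite inE /= => /andP[YT /eqP YX].
  have ex_j j : exists ib : 'I_k * bool, v j *m X == (-1) ^+ ib.2 *: v ib.1.
    move: YT; rewrite inE => /andP[/forallP/(_ j)/tag_supportP[i [b]] + _].
    rewrite row_mul -[Y]hsubmxK YX mul_mx_row row_mxKl => E.
    by exists (i, b); rewrite E.
  pose fe j := xchoose (ex_j j); pose f j := (fe j).1; pose e j := (fe j).2.
  have vX j : v j *m X = (-1) ^+ e j *: v (f j) by apply/eqP/(xchooseP (ex_j j)).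
  have sumT Z : row_mx X Z \in T ->
      \sum_j (-1) ^+ e j *: row_mx (delta_mx 0 (f j))
        (mxvec (\matrix_(l < n) P (f j) ((-1) ^+ e j * (v j *m col l Z) 0 0))) = 0.
    rewrite inE => /andP[_ /eqP E]; rewrite -[RHS]E; apply: eq_bigr => j _.
    by rewrite row_mul -(phase_tag_row_mx _ _ _ _ _ _ _ _ _ _ _ p_pr p_odd k_gt1 v_ind (vX j)).
  have f_const : forall i j, f i = f j.
    apply: (const_of_signed_sum_eq0 _ _ _ _ _ _ p_pr p_odd k_gt1 v_ind vX).
    have := sumT (rsubmx Y); rewrite -YX hsubmxK => /(_ YT)/(congr1 lsubmx).
    rewrite linear_sum linear0 => E; rewrite -[RHS]E /=; apply: eq_bigr => j _.
    by rewrite linearZ /= row_mxKl.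
  have i : 'I_k by exists 0%N; apply: ltnW.
  have f_i j : f j = f i by apply: f_const.
  have vfi : v (f i) != 0 by apply: independent_neq0.
  (* Normalising [q] against [v (f i)] gives [X *m q] the values [(-1) ^+ e j] that [Pneq0]
     requires. *)
  have [q q1] : exists q : 'cV['F_p]_2, (v (f i) *m q) 0 0 = 1.
    have /rV0Pn[l vl] := vfi; exists ((v (f i) 0 l)^-1 *: delta_mx l 0).
    by rewrite -scalemxAr -colE mxE [col _ _ _ _]mxE mulVf.
  have [|y Py] := Pneq0 (f i) e (X *m q).
    by move=> j; rewrite mulmxA vX f_i -scalemxAl mxE q1 mulr1.
  (* A column equal to [y] would leave a nonzero block in the total tag. *)
  exists y => Z ZT l; apply: contraNneq Py => ly.
  have := sumT Z ZT; move/(congr1 (row l \o vec_mx \o rsubmx))/eqP => /=.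
  rewrite !linear_sum /= !linear0 => /eqP E; apply/eqP; rewrite -[RHS]E.
  apply: eq_bigr => j _; rewrite !linearZ /= row_mxKr mxvecK rowK f_i ly.
  done.
have [y yP] := fin_all_exists avoid.
(* Solutions are grouped by left block; each group embeds into the maps from the [n] columns to
   vectors other than [y X]. *)
rewrite -sum1_card (partition_big (@lsubmx _ _ _ _) xpredT) //=.
rewrite -sum_nat_const; apply: leq_sum => X _; rewrite sum1_card.
pose cols (Y : 'M['F_p]_(2, 2 + n)) := [ffun l => col l (rsubmx Y)].
rewrite -(@card_in_image _ _ cols) => [|Y Y' /andP[_ /eqP YX] /andP[_ /eqP YX'] e].
  have -> : (#|{: 'cV['F_p]_2}|.-1 ^ n =
      #|ffun_on (predC1 (y X)) : pred {ffun 'I_n -> 'cV['F_p]_2}|)%N.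
    by rewrite card_ffun_on cardC1 card_ord.
  apply: subset_leq_card; apply/subsetP => _ /imageP[Y /andP[YT /eqP YX] ->].
  apply/ffun_onP => l; rewrite ffunE inE; apply: yP.
  by rewrite -YX hsubmxK.
rewrite -[Y]hsubmxK -[Y']hsubmxK YX YX'; congr row_mx.
apply/matrixP => a l; have /ffunP/(_ l) := e; rewrite !ffunE.
by move/matrixP/(_ a 0); rewrite !mxE.
Qed.

(** * Affine coordinates and the construction of [P] *)

Lemma exists_unit_row_mx (F : fieldType) (phi : 'cV[F]_2) :
  phi != 0 -> exists y : 'cV_2, row_mx phi y \in unitmx.
Proof.
case/cV0Pn => a phia; have other (l : 'I_2) : l != a -> l = rev_ord a.
  by case: l a {phia} => [[|[|l]] lt_l] [[|[|a]] lt_a] //= _; apply/val_inj.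
exists (delta_mx (rev_ord a) 0); rewrite unitmxE unitfE; apply/det0P => -[w w_neq0 w0].
have /eq_row_mx[wphi] : row_mx (w *m phi) (w *m (delta_mx (rev_ord a) 0 : 'cV_2)) = row_mx 0 0.
  by rewrite -mul_mx_row row_mx0; exact: w0.
rewrite -colE => /matrixP/(_ 0 0); rewrite !mxE => wb.
case/rV0Pn: w_neq0 => l; have [->|/other->] := eqVneq l a; last by rewrite wb eqxx.
move/matrixP/(_ 0 0): wphi; rewrite !mxE (bigD1 a) //= big1 ?addr0 => [|i /other->].
  by move/eqP; rewrite mulf_eq0 (negPf phia) orbF => ->.
by rewrite wb mul0r.
Qed.

(* In coordinates whose first functional is phi, the signed vectors are the
   points (1, t j) of an affine line. *)
Lemma signed_coordinates (p k : nat) (v : 'I_k -> 'rV['F_p]_2)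
    (e : 'I_k -> bool) (phi : 'cV['F_p]_2) :
  prime p -> odd p -> (1 < k)%N -> independent v ->
  (forall j, (v j *m phi) 0 0 = (-1) ^+ e j) ->
  exists y0 : 'cV['F_p]_2,
    injective (fun j => (-1) ^+ e j * (v j *m y0) 0 0) /\
    forall y : 'cV['F_p]_2, exists a b, forall j,
      (-1) ^+ e j * (v j *m y) 0 0 = a + b * ((-1) ^+ e j * (v j *m y0) 0 0).
Proof.
move=> p_pr p_odd k_gt1 v_ind vphi.
have phi_neq0 : phi != 0.
  apply/eqP => phi0; have j : 'I_k by exists 0%N; apply: ltnW.
  by have /esym/eqP := vphi j; rewrite phi0 mulmx0 mxE signr_eq0.
have [y0 U] := exists_unit_row_mx _ _ phi_neq0; exists y0; split.
  move=> i j /= tij.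
  have : ((-1) ^+ e i *: v i) *m row_mx phi y0 = ((-1) ^+ e j *: v j) *m row_mx phi y0.
    rewrite !mul_mx_row; congr row_mx; apply/matrixP => a b; rewrite !ord1 -!scalemxAl.
      by rewrite [LHS]mxE [RHS]mxE !vphi -!signr_addb !addbb.
    by rewrite [LHS]mxE [RHS]mxE.
  have /row_free_inj inj : row_free (row_mx phi y0) by rewrite row_free_unit.
  by move/inj/(sign_scale_inj _ _ _ _ _ _ _ p_pr p_odd k_gt1 v_ind) => [].
move=> y; have -> : y = row_mx phi y0 *m (invmx (row_mx phi y0) *m y).
  by rewrite mulKVmx.
(* [z] holds the coordinates of [y] in the basis [phi], [y0]; the signed values of [phi] are 1,
   hence the constant term [a]. *)
move: (invmx _ *m y) => z; exists (z 0 0), (z 1 0) => j.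
have -> : (v j *m (row_mx phi y0 *m z)) 0 0 =
    (v j *m phi) 0 0 * z 0 0 + (v j *m y0) 0 0 * z 1 0.
  rewrite mulmxA mxE.
  rewrite (_ : v j *m row_mx phi y0 = row_mx (v j *m phi) (v j *m y0)); last exact: mul_mx_row.
  rewrite (big_ord_recl 1) big_ord1.
  congr (_ * z _ _ + _ * z _ _); try exact: val_inj.
    by rewrite -(row_mxEl (v j *m phi) (v j *m y0)); congr (row_mx _ _ _ _); apply: val_inj.
  by rewrite -(row_mxEr (v j *m phi) (v j *m y0)); congr (row_mx _ _ _ _); apply: val_inj.
rewrite vphi mulrDr [_ * (_ * z 0 0)]mulrA -signr_addb addbb expr0 mul1r; congr (_ + _).
by rewrite [RHS]mulrC mulrA.
Qed.

(** Summed with varying [j], the Lagrange weights [c j] annihilate polynomials of degree at most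
    [k - 2]. With [i] fixed the weight factors out, and the remaining signs cannot annihilate all
    these powers. *)
Lemma exists_tags (p k : nat) (v : 'I_k -> 'rV['F_p]_2) :
  prime p -> odd p -> ~~ odd k -> (4 <= k)%N -> independent v ->
  exists (m : nat) (P : 'I_k -> 'F_p -> 'rV['F_p]_m),
    (forall y : 'cV_2, \sum_j P j ((v j *m y) 0 0) = 0) /\
    forall i (e : 'I_k -> bool) (phi : 'cV_2),
      (forall j, (v j *m phi) 0 0 = (-1) ^+ e j) ->
      exists y : 'cV_2, \sum_j (-1) ^+ e j *: P i ((-1) ^+ e j * (v j *m y) 0 0) != 0.
Proof.
move=> p_pr p_odd k_even k_ge4 v_ind.
have k_gt1 : (1 < k)%N by apply: leq_trans k_ge4.
have [/existsP[[phi d] /= /forallP vphi]|no_phi] := boolP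
    [exists phid : 'cV['F_p]_2 * {ffun 'I_k -> bool},
     forall j, (v j *m phid.1) 0 0 == (-1) ^+ phid.2 j]; last first.
  (* Without such a [phi] the second condition is vacuous. *)
  exists 0, (fun _ _ => 0); split=> [y|i e phi vphi]; first by rewrite big1.
  case/negP: no_phi; apply/existsP; exists (phi, finfun e); apply/forallP => j /=.
  by rewrite vphi ffunE.
have [y0 [t_inj yE]] := signed_coordinates _ _ _ _ _ p_pr p_odd k_gt1 v_ind
  (fun j => eqP (vphi j)).
set t := fun j => _ in t_inj yE.
have [c [c_neq0 ct]] := exists_power_relation _ _ _ (ltnW k_gt1) t_inj.
exists k.-1, (fun j x => \row_s (c j * ((-1) ^+ d j * x) ^+ s)); split.
  move=> y; apply/rowP => s; rewrite summxE mxE.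
  have [a [b abE]] := yE y.
  (* The signed value at [y] is [a + b * t j], so its power [s] is a polynomial in [t j] that [c]
     annihilates. *)
  have sz : (size ((a%:P + b *: 'X) ^+ s)%R <= k.-1)%N.
    apply: leq_trans (size_poly_exp_leq _ _) _.
    apply: leq_ltn_trans (ltn_ord s); rewrite -[X in (_ <= X)%N]mul1n leq_mul2r.
    apply/orP; right; rewrite -subn1 leq_subLR.
    apply: leq_trans (size_polyD _ _) _; rewrite geq_max.
    rewrite (leq_trans (size_polyC_leq1 _)) //.
    by rewrite (leq_trans (size_scale_leq _ _)) ?size_polyX.
  rewrite -[RHS](sum_horner_eq0 _ _ _ _ _ ct _ sz); apply: eq_bigr => j _.
  by rewrite mxE abE horner_exp !hornerE.
move=> i e psi ephi.
have [y1 [t1_inj _]] := signed_coordinates _ _ _ _ _ p_pr p_odd k_gt1 v_ind ephi.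
have [s s_neq0] := signed_power_sum_neq0 _ _ _ e p_pr p_odd k_even k_ge4 t1_inj.
exists y1; apply: contra s_neq0 => /eqP/rowP/(_ s); rewrite summxE mxE => E.
have cs : c i * (-1) ^+ d i ^+ s != 0 by rewrite mulf_neq0 // expf_neq0 // signr_eq0.
apply/eqP/(mulfI cs); rewrite mulr0 -[RHS]E mulr_sumr; apply: eq_bigr => j _.
rewrite [RHS]mxE [X in _ = _ * X]mxE [in RHS]exprMn.
by rewrite mulrCA -mulrA.
Qed.

(** * Growth comparison and the two parities of [k] *)

Lemma exists_expn_dominates (a r : nat) : (0 < r)%N ->
  exists n, (a * r ^ n < r.+1 ^ n)%N.
Proof.
move=> r_gt0.
(* Bernoulli's inequality for [(1 + 1/r)^m], cleared of denominators. At [m = r] it gives a factor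
   2, and [2^(a + 1)] exceeds [a]. *)
have bern m : ((r + m) * r ^ m <= r * r.+1 ^ m)%N.
  elim: m => [|m IH]; first by rewrite addn0.
  rewrite !expnS mulnCA [X in (_ <= X)%N]mulnCA.
  apply: leq_trans (leq_mul (leqnn r.+1) IH); rewrite !mulnA leq_mul2r.
  by rewrite addnS mulnS mulSn leq_add2r leq_addr orbT.
have double : (2 * r ^ r <= r.+1 ^ r)%N.
  by rewrite -(leq_pmul2l r_gt0) (leq_trans _ (bern r)) // addnn -mul2n mulnCA mulnA.
exists (r * a.+1)%N; rewrite !expnM.
have le_pow : ((2 * r ^ r) ^ a.+1 <= (r.+1 ^ r) ^ a.+1)%N by rewrite leq_exp2r.
apply: leq_trans le_pow; rewrite expnMn ltn_pmul2r ?expn_gt0 ?r_gt0 //.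
by apply: ltnW; apply: ltn_expl.
Qed.

(** Dependent columns [i] and [j] would share a nonzero annihilator [u]; by full rank [u *m M] would
    be a nonzero equation of length at most [k - 2]. *)
Lemma independent_columns (p k : nat) (M : 'M['F_p]_(2, k)) :
  \rank M = 2%N -> min_length M = k.-1 -> (3 <= k)%N ->
  independent (fun j => row j M^T).
Proof.
move=> M_rank M_len k_ge3 i j ij; rewrite unitmxE unitfE -det_tr.
apply/det0P => -[u u_neq0 u0].
have /eq_row_mx[ui uj] : row_mx (u *m col i M) (u *m col j M) = row_mx 0 0.
  by rewrite -mul_mx_row row_mx0 -[RHS]u0 tr_col_mx !tr_row !trmxK.
have col0 l : u *m col l M = 0 -> (u *m M) 0 l = 0.
  by rewrite colE mulmxA -colE => /matrixP/(_ 0 0); rewrite !mxE.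
have M_free : row_free M by rewrite /row_free M_rank.
have uM_neq0 : u *m M != 0.
  by apply: contra u_neq0 => /eqP uM; apply/eqP/(row_free_inj M_free); rewrite mul0mx.
have : (k.-1 <= eqn_length (u *m M))%N.
  rewrite -M_len; apply: (@bigmin_le_cond _ nat _ k (u *m M)
    (fun v => (v != 0) && (v <= M)%MS) (@eqn_length p k)).
  by rewrite uM_neq0 submxMl.
apply/negP; rewrite -ltnNge.
have : (eqn_length (u *m M) <= #|~: [set i; j]|)%N.
  apply: subset_leq_card; apply/subsetP => l; rewrite !inE negb_or.
  by move=> ul; apply/andP; split; apply: contraNneq ul => ->; rewrite col0.
move/leq_ltn_trans; apply; rewrite -ltnS prednK; last exact: ltn_trans k_ge3.
have := cardsC [set i; j]; rewrite cards2 ij card_ord.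
move: #|~: _| => c <-.
exact: leqnn.
Qed.

Lemma exists_neg_T_avg_even (R : rcfType) (p k : nat) (M : 'M['F_p]_(2, k)) :
  prime p -> odd p -> ~~ odd k -> (4 <= k)%N ->
  independent (fun j => row j M^T) ->
  exists (n : nat) (f : 'rV['F_p]_n -> R),
    [/\ (0 < n)%N, average [set: 'rV['F_p]_n] f = 0 & T_avg M f < 0].
Proof.
move=> p_pr p_odd k_even k_ge4 v_ind.
have k_gt1 : (1 < k)%N by apply: leq_trans k_ge4.
have [m [P [P0 Pneq0]]] := exists_tags _ _ _ p_pr p_odd k_even k_ge4 v_ind.
have r_gt0 : (0 < #|{: 'cV['F_p]_2}|.-1)%N.
  rewrite card_mx card_Fp // -subn1 subn_gt0 (ltn_trans (prime_gt1 p_pr)) //.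
  by rewrite muln1 -[X in (X < _)%N]expn1 ltn_exp2l ?prime_gt1.
(* This [n] satisfies [p^4 (p^2 - 1)^n < p^(2n)], which separates the two counts. *)
have [n n_dom] := exists_expn_dominates #|{: 'M['F_p]_2}| _ r_gt0.
have [f [f0 fT]] : exists f : 'rV['F_p]_(2 + n) -> R,
    average [set: 'rV['F_p]_(2 + n)] f = 0 /\ T_avg M f < 0.
  pose v j := row j M^T.
  apply: (exists_neg_T_avg_of_tags R _ _ M _ _ (tag_support v n) (phase_tag v P)
    (row_mx (const_mx 1) 0) p_pr).
  - exact: tag_support0.
  - exact: tag_supportN.
  - exact: phase_tagN.
  apply: leq_ltn_trans (tagged_solutions_upper _ _ _ _ _ _ p_pr p_odd k_gt1 v_ind Pneq0) _.
  apply: leq_trans (tagged_solutions_lower _ _ _ _ _ _ p_pr p_odd k_gt1 v_ind P0).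
  have -> : #|{: 'M['F_p]_(2, n)}| = (#|{: 'cV['F_p]_2}| ^ n)%N.
    by rewrite !card_mx muln1 expnM.
  by rewrite prednK // in n_dom; apply/card_gt0P; exists 0.
by exists (2 + n)%N, f; split.
Qed.

(** With all nonzero frequencies and tags in dimension 0, [char_sum] is a multiple of a delta
    function minus its mean. The sum then counts the [Y] that keep every [v j *m Y] nonzero, among
    them the identity. *)
Lemma exists_neg_T_avg_odd (R : rcfType) (p k : nat) (M : 'M['F_p]_(2, k)) :
  prime p -> odd k -> (forall j, row j M^T != 0) ->
  exists f : 'rV['F_p]_2 -> R,
    average [set: 'rV['F_p]_2] f = 0 /\ T_avg M f < 0.
Proof.
move=> p_pr k_odd M_col.
have [chi [chiD chi1 chiJ]] := additive_character R[i] _ p_pr.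
have chi0 : chi 0 = 1 by apply/eqP; rewrite chi1.
pose S : {set 'rV['F_p]_2} := ~: [set 0].
pose g (xi : 'rV['F_p]_2) : 'rV['F_p]_0 := 0.
apply: (exists_neg_T_avg_of_complex _ _ _ M _ (fun x => - char_sum chi S g 0 x)).
- move=> x; rewrite rmorphN /= char_sum_conj // => [xi|xi _]; last by rewrite oppr0.
  by rewrite !inE oppr_eq0.
- by rewrite sumrN sum_char_sum ?oppr0 // !inE eqxx.
under eq_bigr => x _ do rewrite prodrN card_ord -signr_odd k_odd mulN1r.
rewrite sumrN oppr_lt0.
have q_gt0 m : (0 : R[i]) < #|{: 'M['F_p]_(m, 2)}|%:R.
  by rewrite ltr0n; apply/card_gt0P; exists 0.
rewrite -(pmulr_rgt0 _ (q_gt0 2%N)) sum_sol_char_sum // pmulr_rgt0 ?exprn_gt0 //.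
under eq_bigr => Y _ do rewrite frobC frob0r chi0.
rewrite sumr_const ltr0n; apply/card_gt0P; exists 1%:M.
by apply/forallP => j; rewrite mulmx1 !inE M_col.
Qed.

Theorem theorem3p3 (R : realType) (p k : nat) (M : 'M['F_p]_(2, k)) :
  prime p -> (2 < p)%N -> (3 <= k)%N ->
  \rank M = 2%N -> min_length M = k.-1 ->
  exists (n : nat) (f : 'rV['F_p]_n -> R),
    [/\ (0 < n)%N,
        forall x, -1 <= f x <= 1,
        average [set: 'rV['F_p]_n] f = 0
      & T_avg M f < 0].
Proof.
move=> p_pr p_gt2 k_ge3 M_rank M_len.
have v_ind := independent_columns _ _ _ M_rank M_len k_ge3.
suff [n [f [n_gt0 f0 fT]]] : exists (n : nat) (f : 'rV['F_p]_n -> R),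
    [/\ (0 < n)%N, average [set: 'rV['F_p]_n] f = 0 & T_avg M f < 0].
  have [f' [f'_bd f'0 f'T]] := exists_bounded_of_neg_T_avg _ _ _ _ _ _ f0 fT.
  by exists n, f'; split.
have [k_odd|k_even] := boolP (odd k); last first.
  apply: exists_neg_T_avg_even => //.
    by case: (even_prime p_pr) p_gt2 => [->|->].
  by rewrite ltn_neqAle k_ge3 andbT; apply: contra k_even => /eqP<-.
have [f [f0 fT]] : exists f : 'rV['F_p]_2 -> R,
    average [set: 'rV['F_p]_2] f = 0 /\ T_avg M f < 0.
  apply: exists_neg_T_avg_odd => // j.
  by apply: (independent_neq0 _ _ _ _ p_pr _ v_ind); apply: leq_trans k_ge3.
by exists 2%N, f; split.
Qed.
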